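(* In the setting of the context, there exists an input sequence $(u_k)_{k=0}^{N-1}$ in $\mathbb R^m$ such that the trajectory defined by $x_0=\bar x$, $x_{k+1}=f_k+A_kx_k+B_k^1u_k$ satisfies $v_{ki}^\top v_{ki}<1$ for all $k=0,\dots,N-1$ and $i=1,\dots,s$, where $v_{ki}=g_{ki}^2+C_{ki}^2x_k+D_{ki}^{21}u_k$, if and only if the semidefinite program (SDP) of the context is strictly feasible.
   Context: Fix $N,n,m,s\in\mathbb N$. The data are real matrices/vectors of compatible sizes: $f_k\in\mathbb R^n$, $A_k\in\mathbb R^{n\times n}$, $B_k^1\in\mathbb R^{n\times m}$, $g_k^1,C_k^1,D_k^{11}$, and $g_{ki}^2,C_{ki}^2,D_{ki}^{21}$ for $k=0,\dots,N-1$, $i=1,\dots,s$; $P_f\in\mathbb R^{(1+n)\times(1+n)}$ is symmetric positive definite; $\bar x\in\mathbb R^n$; $\Sigma_0:=\begin{pmatrix}1\\ \bar x\end{pmatrix}\begin{pmatrix}1\\ \bar x\end{pmatrix}^\top$ with positive semidefinite square root $\sqrt{\Sigma_0}$. They define the optimal control problem of minimizing $\sum_{k=0}^{N-1}y_k^\top y_k+\begin{pmatrix}1\\ x_N\end{pmatrix}^\top P_f\begin{pmatrix}1\\ x_N\end{pmatrix}$ over $(u_k)_{k=0}^{N-1}$ subject to $x_{k+1}=f_k+A_kx_k+B_k^1u_k$, $x_0=\bar x$, $y_k=g_k^1+C_k^1x_k+D_k^{11}u_k$, $v_{ki}=g_{ki}^2+C_{ki}^2x_k+D_{ki}^{21}u_k$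 and $v_{ki}^\top v_{ki}\le1$. The (SDP) is its convex relaxation: maximize $\tilde\nu$ over symmetric matrices $\widetilde P_k=\begin{pmatrix}\tilde p_k^{11}&\tilde p_k^{12}\\ \tilde p_k^{21}&\widetilde P_k^{22}\end{pmatrix}\in\mathbb R^{(1+n)\times(1+n)}$ ($k=0,\dots,N$, $\tilde p_k^{11}\in\mathbb R$), matrices $\widetilde K_k=\begin{pmatrix}\tilde k_k^1&\widetilde K_k^2\end{pmatrix}\in\mathbb R^{m\times(1+n)}$ ($k=0,\dots,N-1$), a scalar $\tilde\nu\in\mathbb R$ and a symmetric matrix $Z\in\mathbb R^{(1+n)\times(1+n)}$ subject to (L1) $\begin{pmatrix}\tilde p_{k+1}^{11}&\tilde p_{k+1}^{12}&0&\tilde p_k^{11}&\tilde p_k^{12}\\ \tilde p_{k+1}^{21}&\widetilde P_{k+1}^{22}&0&\tilde f_k^K&\widetilde A_k^K\\ 0&0&I&\tilde g_k^{1K}&\widetilde C_k^{1K}\\ \tilde p_k^{11}&(\tilde f_k^K)^\top&(\tilde g_k^{1K})^\top&\tilde p_k^{11}&\tilde p_k^{12}\\ \tilde p_k^{21}&(\widetilde A_k^K)^\top&(\widetilde C_k^{1K})^\top&\tilde p_k^{21}&\widetilde P_k^{22}\end{pmatrix}\succeq0$ for $k=0,\dots,N-1$; (L2) $\begin{pmatrix}\widetilde P_0&\tilde\nu\sqrt{\Sigma_0}\\ \tilde\nu\sqrt{\Sigma_0}^\top&Z\end{pmatrix}\succeq0$ and $\mathrm{trace}\,Z\le\tilde\nu$;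 (L3) $\widetilde P_N\preceq P_f^{-1}$; (L4) $\begin{pmatrix}\tilde p_k^{11}&\tilde p_k^{12}&(\tilde g_{ki}^{2K})^\top\\ \tilde p_k^{21}&\widetilde P_k^{22}&(\widetilde C_{ki}^{2K})^\top\\ \tilde g_{ki}^{2K}&\widetilde C_{ki}^{2K}&\tilde\nu I\end{pmatrix}\succeq0$ for $k=0,\dots,N-1$, $i=1,\dots,s$, where $$\begin{pmatrix}\tilde f_k^K&\widetilde A_k^K\\ \tilde g_k^{1K}&\widetilde C_k^{1K}\\ \tilde g_{ki}^{2K}&\widetilde C_{ki}^{2K}\end{pmatrix}:=\begin{pmatrix}f_k&A_k&B_k^1\\ g_k^1&C_k^1&D_k^{11}\\ g_{ki}^2&C_{ki}^2&D_{ki}^{21}\end{pmatrix}\begin{pmatrix}\tilde p_k^{11}&\tilde p_k^{12}\\ \tilde p_k^{21}&\widetilde P_k^{22}\\ \tilde k_k^1&\widetilde K_k^2\end{pmatrix}.$$ $\succeq,\preceq$ denote the Loewner order. Strict feasibility of (SDP) means that there are values of the decision variables for which all of these inequalities hold strictly (each matrix inequality $\succeq0$ with $\succ0$, $\widetilde P_N\prec P_f^{-1}$, and $\mathrm{trace}\,Z<\tilde\nu$). *)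

(* Defs.v *)
From HB Require Import structures.
From mathcomp Require Import all_boot all_order all_algebra.
From mathcomp Require Import boolp classical_sets reals.

Set Implicit Arguments.
Unset Strict Implicit.
Unset Printing Implicit Defensive.

Import Order.TTheory GRing.Theory Num.Theory.
Local Open Scope ring_scope.

Definition psdmx (R : realType) (d : nat) (M : 'M[R]_d) : Prop :=
  M^T = M /\ forall v : 'cV[R]_d, 0 <= (v^T *m M *m v) 0 0.

Definition pdmx (R : realType) (d : nat) (M : 'M[R]_d) : Prop :=
  M^T = M /\ forall v : 'cV[R]_d, v != 0 -> 0 < (v^T *m M *m v) 0 0.

Definition loewner_lt (R : realType) (d : nat) (M M' : 'M[R]_d) : Prop :=
  pdmx (M' - M).

(* The positive semidefinite square root; the value is the junk matrix 0 when M
   is not positive semidefinite. *)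
Definition sqrtmx (R : realType) (d : nat) (M : 'M[R]_d) : 'M[R]_d :=
  xget 0 [set S : 'M[R]_d | psdmx S /\ S *m S = M]%classic.

(* The output dimensions [dimy k] of y_k and [dimv k i] of v_{ki} are unconstrained
   and may depend on the indices. *)
Record ocp (R : realType) (N n m s : nat) : Type := Ocp {
  f_ : 'I_N -> 'cV[R]_n;
  A_ : 'I_N -> 'M[R]_n;
  B1_ : 'I_N -> 'M[R]_(n, m);
  dimy : 'I_N -> nat;
  g1_ : forall k, 'cV[R]_(dimy k);
  C1_ : forall k, 'M[R]_(dimy k, n);
  D11_ : forall k, 'M[R]_(dimy k, m);
  dimv : 'I_N -> 'I_s -> nat;
  g2_ : forall k i, 'cV[R]_(dimv k i);
  C2_ : forall k i, 'M[R]_(dimv k i, n);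
  D21_ : forall k i, 'M[R]_(dimv k i, m);
  Pf : 'M[R]_(1 + n);
  xbar : 'cV[R]_n
}.

(* For a stage k in {0, ..., N-1}, the times k and k+1 in {0, ..., N}. *)
Definition now (N : nat) (k : 'I_N) : 'I_N.+1 := widen_ord (leqnSn N) k.
Definition next (N : nat) (k : 'I_N) : 'I_N.+1 := lift ord0 k.

Section ControlProblem.
Variables (R : realType) (N n m s : nat) (p : ocp R N n m s).

Definition trajectory (u : 'I_N -> 'cV[R]_m) (x : 'I_N.+1 -> 'cV[R]_n) : Prop :=
  x ord0 = xbar p /\
  forall k : 'I_N,
    x (next k) = f_ p k + A_ p k *m x (now k) + B1_ p k *m u k.

Definition voutput (u : 'I_N -> 'cV[R]_m) (x : 'I_N.+1 -> 'cV[R]_n)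
    (k : 'I_N) (i : 'I_s) : 'cV[R]_(dimv p k i) :=
  g2_ p k i + C2_ p k i *m x (now k) + D21_ p k i *m u k.

Definition Sigma0 : 'M[R]_(1 + n) :=
  col_mx (1%:M : 'M[R]_1) (xbar p) *m (col_mx (1%:M : 'M[R]_1) (xbar p))^T.

End ControlProblem.

Record sdp_var (R : realType) (N n m : nat) : Type := SdpVar {
  P_ : 'I_N.+1 -> 'M[R]_(1 + n);
  K_ : 'I_N -> 'M[R]_(m, 1 + n);
  nu : R;
  Z : 'M[R]_(1 + n)
}.

Section SDP.
Variables (R : realType) (N n m s : nat).
Variables (p : ocp R N n m s) (w : sdp_var R N n m).

(* (f_k^K  A_k^K), (g_k^{1K}  C_k^{1K}) and (g_{ki}^{2K}  C_{ki}^{2K}): the block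
   rows of the data matrix times (P_k ; K_k). *)
Definition fAK (k : 'I_N) : 'M[R]_(n, 1 + n) :=
  row_mx (row_mx (f_ p k) (A_ p k)) (B1_ p k) *m col_mx (P_ w (now k)) (K_ w k).

Definition gC1K (k : 'I_N) : 'M[R]_(dimy p k, 1 + n) :=
  row_mx (row_mx (g1_ p k) (C1_ p k)) (D11_ p k)
    *m col_mx (P_ w (now k)) (K_ w k).

Definition gC2K (k : 'I_N) (i : 'I_s) : 'M[R]_(dimv p k i, 1 + n) :=
  row_mx (row_mx (g2_ p k i) (C2_ p k i)) (D21_ p k i)
    *m col_mx (P_ w (now k)) (K_ w k).

(* Row and column sizes 1, n, dimy p k, 1, n. In the off-diagonal blocks,
   [usubmx (P_ w (now k))] is (p_k^11  p_k^12) and [lsubmx (P_ w (now k))] is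
   (p_k^11 ; p_k^21). *)
Definition lmi_dynamics (k : 'I_N) : 'M[R]_((1 + n) + dimy p k + (1 + n)) :=
  block_mx
    (block_mx (P_ w (next k)) 0
              0               1%:M)
    (col_mx (col_mx (usubmx (P_ w (now k))) (fAK k)) (gC1K k))
    (row_mx (row_mx (lsubmx (P_ w (now k))) (fAK k)^T) (gC1K k)^T)
    (P_ w (now k)).

Definition lmi_initial : 'M[R]_((1 + n) + (1 + n)) :=
  block_mx (P_ w ord0)                      (nu w *: sqrtmx (Sigma0 p))
           (nu w *: (sqrtmx (Sigma0 p))^T) (Z w).

Definition lmi_output (k : 'I_N) (i : 'I_s) : 'M[R]_((1 + n) + dimv p k i) :=
  block_mx (P_ w (now k)) (gC2K k i)^T
           (gC2K k i)     (nu w)%:M.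

Definition strictly_feasible_point : Prop :=
  [/\ (forall k : 'I_N.+1, (P_ w k)^T = P_ w k) /\ (Z w)^T = Z w,
      forall k : 'I_N, pdmx (lmi_dynamics k),
      pdmx lmi_initial /\ \tr (Z w) < nu w,
      loewner_lt (P_ w ord_max) (invmx (Pf p)) &
      forall (k : 'I_N) (i : 'I_s), pdmx (lmi_output k i)].

End SDP.

Definition sdp_strictly_feasible (R : realType) (N n m s : nat)
    (p : ocp R N n m s) : Prop :=
  exists w : sdp_var R N n m, strictly_feasible_point p w.

(* Main.v *)
(** By Schur complements, and with [V_k = P_k^-1] and [lam = 1 / nu], the program
is strictly feasible iff some feedback [u_k = kap_k (1, x_k)] admits quadratic
forms with [V_k > A^T V_{k+1} A + C^T C], [V_N > Pf], [V_k > lam G^T G] and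
[V_0 (1, xbar) < lam], where [A], [C], [G] are the closed-loop matrices giving
[(1, x_{k+1})], [y_k] and [v_ki]. Such forms decrease along the closed-loop
trajectory, so [lam |v_ki|^2 < V_k (1, x_k) < lam].

Conversely, apply the strictly feasible inputs in open loop, so that [kap_k] has
no linear part. Any finite set of quadratic forms whose values at [(1, x_k)] are
less than [a] is strictly dominated by a form taking the value [a] there; this
yields the [V_k] by backward induction, with values increasing slightly
backwards in time and remaining below [lam] once [lam] is large. *)

Require Import Defs.
From mathcomp Require Import all_boot all_order all_algebra.
From mathcomp Require Import boolp classical_sets reals.
From mathcomp Require Import lra.
Import Order.TTheory GRing.Theory Num.Theory.
Local Open Scope ring_scope.

(** * Induction and recursive constructions along the time stages *)

Section Stages.
Set Implicit Arguments.
Unset Strict Implicit.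

Lemma now_lift0 N (k : 'I_N) : now (lift ord0 k) = lift ord0 (now k).
Proof. exact: val_inj. Qed.

Lemma now_ord0 N : now (@ord0 N) = ord0.
Proof. exact: val_inj. Qed.

Lemma now_neq_max N (k : 'I_N) : now k <> ord_max.
Proof.
by move/(congr1 (@nat_of_ord _)) => /= kN; have := ltn_ord k; rewrite {1}kN ltnn.
Qed.

Lemma stage_ind N (Q : 'I_N.+1 -> Prop) :
  Q ord0 -> (forall k : 'I_N, Q (now k) -> Q (Defs.next k)) -> forall k, Q k.
Proof.
move=> Q0 QS [j]; elim: j => [|j IH] jN.
  by have -> : Ordinal jN = ord0 by apply: val_inj.
have jN' : (j < N)%N by [].
have -> : Ordinal jN = Defs.next (Ordinal jN') by apply: val_inj.
apply: QS; have -> : now (Ordinal jN') = Ordinal (ltnW jN) by apply: val_inj.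
exact: IH.
Qed.

Lemma forward_family T N (F : 'I_N -> T -> T) (t0 : T) :
  exists t : 'I_N.+1 -> T,
    t ord0 = t0 /\ forall k, t (Defs.next k) = F k (t (now k)).
Proof.
elim: N F t0 => [|N IH] F t0.
  by exists (fun=> t0); split=> // -[].
have [t [tO tS]] := IH (fun k => F (lift ord0 k)) (F ord0 t0).
exists (fun k => if unlift ord0 k is Some k' then t k' else t0).
rewrite unlift_none; split=> // k; rewrite /Defs.next liftK.
have [k' ->|->] := unliftP ord0 k; last by rewrite now_ord0 unlift_none tO.
by rewrite now_lift0 liftK -tS.
Qed.

(** Induction on [N]: the entries at times 1 to [N] are built first, and the entry at time 0 is then
    chosen from its successor. As [S] is a relation, each stage only requires that a predecessor
    exists. *)
Lemma backward_family T N (Q : 'I_N.+1 -> T -> Prop)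
    (S : 'I_N -> T -> T -> Prop) :
  (exists t, Q ord_max t) ->
  (forall k t', Q (Defs.next k) t' -> exists t, Q (now k) t /\ S k t t') ->
  exists t : 'I_N.+1 -> T,
    (forall k, Q k (t k)) /\ forall k, S k (t (now k)) (t (Defs.next k)).
Proof.
elim: N Q S => [|N IH] Q S [tN QN] QS.
  exists (fun=> tN); split=> [k|[]//].
  by have -> : k = ord_max by rewrite (ord1 k); apply: val_inj.
have [|k t'|t [Qt St]] := IH (Q \o lift ord0) (S \o lift ord0).
- exists tN => /=.
  by have -> : lift ord0 (@ord_max N) = ord_max by apply: val_inj.
- by move=> /(QS (lift ord0 k)); rewrite now_lift0.
have [t0 [Q0 S0]] := QS ord0 (t ord0) (Qt ord0).
rewrite now_ord0 in Q0.
exists (fun k => if unlift ord0 k is Some k' then t k' else t0); split=> k.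
  by have [k' ->|->] := unliftP ord0 k => //; apply: Qt.
rewrite /Defs.next liftK; have [k' ->|->] := unliftP ord0 k.
  by rewrite now_lift0 liftK; apply: St.
by rewrite now_ord0 unlift_none.
Qed.

End Stages.

(** * Quadratic forms, Schur complements and domination of forms *)

Section QuadraticForms.
Set Implicit Arguments.
Unset Strict Implicit.
Variable R : realType.

Definition qform {d} (M : 'M[R]_d) (v : 'cV[R]_d) : R := (v^T *m M *m v) 0 0.

Lemma qformD d (M1 M2 : 'M[R]_d) v : qform (M1 + M2) v = qform M1 v + qform M2 v.
Proof. by rewrite /qform mulmxDr mulmxDl mxE. Qed.

Lemma qformN d (M : 'M[R]_d) v : qform (- M) v = - qform M v.
Proof. by rewrite /qform mulmxN mulNmx mxE. Qed.

Lemma qformZ d a (M : 'M[R]_d) v : qform (a *: M) v = a * qform M v.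
Proof. by rewrite /qform -scalemxAr -scalemxAl mxE. Qed.

Lemma qform_congr d e (M : 'M[R]_d) (L : 'M_(d, e)) v :
  qform (L^T *m M *m L) v = qform M (L *m v).
Proof. by rewrite /qform trmx_mul !mulmxA. Qed.

Lemma qform_gram d e (L : 'M[R]_(d, e)) v :
  qform (L^T *m L) v = ((L *m v)^T *m (L *m v)) 0 0.
Proof. by rewrite /qform trmx_mul !mulmxA. Qed.

Lemma qform_block d e (M : 'M[R]_d) (N : 'M[R]_e) a b :
  qform (block_mx M 0 0 N) (col_mx a b) = qform M a + qform N b.
Proof.
rewrite /qform tr_col_mx mul_row_block !mulmx0 addr0 add0r mul_row_col.
by rewrite mxE.
Qed.

Lemma normsqE d (v : 'cV[R]_d) : (v^T *m v) 0 0 = \sum_i v i 0 ^+ 2.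
Proof. by rewrite mxE; apply: eq_bigr => i _; rewrite mxE. Qed.

Lemma normsq_ge0 d (v : 'cV[R]_d) : 0 <= (v^T *m v) 0 0.
Proof. by rewrite normsqE sumr_ge0 // => i _; rewrite sqr_ge0. Qed.

Lemma normsq_gt0 d (v : 'cV[R]_d) : v != 0 -> 0 < (v^T *m v) 0 0.
Proof.
move=> v0; rewrite lt_def normsq_ge0 andbT normsqE psumr_neq0; last first.
  by move=> i _; rewrite sqr_ge0.
apply: contraNT v0 => /hasPn v0; apply/eqP/matrixP => i j.
have := v0 i (mem_index_enum i).
by rewrite ord1 mxE /= lt_def sqr_ge0 andbT sqrf_eq0 negbK => /eqP.
Qed.

Lemma qform_scalar d a (v : 'cV[R]_d) : qform a%:M v = a * (v^T *m v) 0 0.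
Proof. by rewrite -scalemx1 qformZ /qform mulmx1. Qed.

Lemma pdmx_ge0 d (M : 'M[R]_d) v : pdmx M -> 0 <= qform M v.
Proof.
move=> [_ h]; have [->|/h/ltW//] := eqVneq v 0.
by rewrite /qform mulmx0 mxE.
Qed.

(** The form vanishes on every row of the left kernel, so these rows are zero. *)
Lemma pdmx_unit d (M : 'M[R]_d) : pdmx M -> M \in unitmx.
Proof.
move=> [MT h]; rewrite -row_free_unit -kermx_eq0.
apply/eqP/row_matrixP => i; rewrite row0.
apply/eqP; apply: contraT => v0.
have := h (row i (kermx M))^T.
have kM : row i (kermx M) *m M = 0 by rewrite -row_mul mulmx_ker row0.
rewrite trmxK kM mul0mx mxE ltxx; apply.
by apply: contraNneq v0 => /(congr1 trmx); rewrite trmxK trmx0 => ->.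
Qed.

Lemma pdmx_congr d e (M : 'M[R]_d) (L : 'M_(d, e)) :
  pdmx M -> (forall v : 'cV_e, L *m v = 0 -> v = 0) -> pdmx (L^T *m M *m L).
Proof.
move=> [MT h] inj; split; first by rewrite !trmx_mul trmxK MT mulmxA.
move=> v v0; rewrite -/(qform _ v) qform_congr; apply: h.
by apply: contraNneq v0 => /inj ->.
Qed.

Lemma pdmx_congr_unit d (M L : 'M[R]_d) : L \in unitmx ->
  pdmx (L^T *m M *m L) <-> pdmx M.
Proof.
have inj (K : 'M[R]_d) : K \in unitmx -> forall v : 'cV_d, K *m v = 0 -> v = 0.
  by move=> Ku v /(congr1 (mulmx (invmx K))); rewrite mulKmx // mulmx0.
move=> Lu; split=> [h|h]; last by apply: pdmx_congr => //; apply: inj.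
have LVu : invmx L \in unitmx by rewrite unitmx_inv.
have := pdmx_congr h (inj _ LVu).
by rewrite !mulmxA trmx_inv mulVmx ?unitmx_tr // mul1mx mulmxK.
Qed.

Lemma pdmx_inv d (M : 'M[R]_d) : pdmx M -> pdmx (invmx M).
Proof.
move=> h; have Mu := pdmx_unit h; have [MT _] := h.
by apply/(pdmx_congr_unit _ Mu); rewrite MT mulmxV // mul1mx.
Qed.

Lemma pdmx_scalar d (a : R) : 0 < a -> pdmx (a%:M : 'M[R]_d).
Proof.
move=> a0; split=> [|v v0]; first by rewrite tr_scalar_mx.
by rewrite -/(qform _ v) qform_scalar mulr_gt0 // normsq_gt0.
Qed.

Lemma pdmx_tr_ge0 d (M : 'M[R]_d) : pdmx M -> 0 <= \tr M.
Proof.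
move=> h; apply: sumr_ge0 => i _.
have := pdmx_ge0 (delta_mx i 0) h.
by rewrite /qform trmx_delta -rowE -colE !mxE.
Qed.

Lemma pdmx_diag_block d e (M : 'M[R]_d) (N : 'M[R]_e) :
  pdmx (block_mx M 0 0 N) <-> pdmx M /\ pdmx N.
Proof.
split=> [[T h]|[[MT hM] [NT hN]]].
  move: T; rewrite tr_block_mx => /eq_block_mx [MT _ _ NT].
  split; split=> // v v0.
    have := h (col_mx v 0); rewrite -/(qform _ (col_mx v 0)) qform_block.
    by rewrite [qform N 0]/qform mulmx0 mxE addr0 col_mx_eq0 negb_and v0; apply.
  have := h (col_mx 0 v); rewrite -/(qform _ (col_mx 0 v)) qform_block.
  rewrite [qform M 0]/qform mulmx0 mxE add0r col_mx_eq0 negb_and v0 orbT.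
  exact.
split=> [|v]; first by rewrite tr_block_mx MT NT !trmx0.
rewrite -[v]vsubmxK -/(qform _ _) qform_block => v0.
have pM : pdmx M by []. have pN : pdmx N by [].
have [a0|a0] := eqVneq (usubmx v) 0; last first.
  by rewrite ltr_pwDl ?pdmx_ge0 // hM.
rewrite ltr_wpDl ?pdmx_ge0 // hN //.
by apply: contraNneq v0 => b0; rewrite a0 b0 col_mx0.
Qed.

Lemma pdmx_ulblock d e (M : 'M[R]_d) (X : 'M[R]_(d, e)) Y (Q : 'M[R]_e) :
  pdmx (block_mx M X Y Q) -> pdmx M.
Proof.
move=> [T h]; move: T; rewrite tr_block_mx => /eq_block_mx [MT _ _ _].
split=> // v v0; have := h (col_mx v 0).
rewrite col_mx_eq0 negb_and v0 => /(_ isT).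
rewrite tr_col_mx mul_row_block trmx0 !mul0mx !addr0 mul_row_col.
by rewrite mulmx0 addr0.
Qed.

(** Block elimination: congruence by a unit upper triangular [L] carries the block diagonal matrix
    of [M] and its Schur complement to the full matrix. *)
Lemma pdmx_schur d e (M : 'M[R]_d) (X : 'M[R]_(d, e)) (Q : 'M[R]_e) :
  M \in unitmx -> M^T = M ->
  pdmx (block_mx M X X^T Q) <-> pdmx M /\ pdmx (Q - X^T *m invmx M *m X).
Proof.
move=> Mu MT; rewrite -pdmx_diag_block.
pose L : 'M[R]_(d + e) := block_mx 1%:M (invmx M *m X) 0 1%:M.
have Lu : L \in unitmx by rewrite unitmxE det_ublock !det1 mulr1 unitr1.
rewrite -(pdmx_congr_unit (block_mx M 0 0 _) Lu).
suff -> : L^T *m block_mx M 0 0 (Q - X^T *m invmx M *m X) *m L =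
  block_mx M X X^T Q by [].
rewrite /L tr_block_mx !trmx1 trmx0 trmx_mul trmx_inv MT !mulmx_block.
rewrite !(mul1mx, mulmx1, mul0mx, mulmx0, addr0, add0r) mulKVmx //.
by rewrite mulmxKV // mulmxA addrC subrK.
Qed.

(** Congruence by the block permutation [J]; this gives access to the Schur complement of the lower
    right block. *)
Lemma pdmx_block_swap d e (M : 'M[R]_d) (X : 'M[R]_(d, e)) (Q : 'M[R]_e) :
  pdmx (block_mx M X X^T Q) <-> pdmx (block_mx Q X^T X M).
Proof.
suff swap : forall d e (M : 'M[R]_d) (X : 'M[R]_(d, e)) (Y : 'M_(e, d))
  (Q : 'M[R]_e), pdmx (block_mx M X Y Q) -> pdmx (block_mx Q Y X M).
  by split; apply: swap.
move=> {M X Q}d {}e M X Y Q h.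
pose J : 'M[R]_(d + e, e + d) := block_mx 0 1%:M 1%:M 0.
suff -> : block_mx Q Y X M = J^T *m block_mx M X Y Q *m J.
  apply: pdmx_congr => // v; rewrite -[v]vsubmxK mul_block_col.
  rewrite !(mul1mx, mul0mx, addr0, add0r) -[0]col_mx0 => /eq_col_mx [-> ->].
  by rewrite col_mx0.
rewrite /J tr_block_mx !trmx1 !trmx0 !mulmx_block.
by rewrite !(mul1mx, mulmx1, mul0mx, mulmx0, addr0, add0r).
Qed.

(** Inversion reverses the strict Loewner order. In [half], [A - invmx B] and [B - invmx A] are the
    two Schur complements of the block matrix with diagonal [B], [A] and identity off-diagonal
    blocks. *)
Lemma pdmx_inv_sub d (M Q : 'M[R]_d) : pdmx M -> pdmx Q ->
  pdmx (invmx Q - M) <-> pdmx (invmx M - Q).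
Proof.
have half (A B : 'M[R]_d) : pdmx A -> pdmx B -> pdmx (A - invmx B) ->
    pdmx (B - invmx A).
  move=> pA pB h; have Au := pdmx_unit pA; have Bu := pdmx_unit pB.
  have [AT _] := pA; have [BT _] := pB.
  have := pdmx_schur (1%:M : 'M_d) A Bu BT.
  rewrite trmx1 mul1mx mulmx1 => /iffRL /(_ (conj pB h)).
  rewrite -{2}[1%:M]trmx1 pdmx_block_swap trmx1 -{2}[1%:M]trmx1.
  by rewrite pdmx_schur // trmx1 mul1mx mulmx1 => -[].
move=> pM pQ; split=> h.
  by rewrite -[Q]invmxK; apply: half; rewrite ?invmxK //; apply: pdmx_inv.
by rewrite -[M]invmxK; apply: half; rewrite ?invmxK //; apply: pdmx_inv.
Qed.

(** The sum [c] of the absolute values of the entries satisfies [qform S v <= c * V] with [V] the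
    squared norm of [v]; adding 1 makes this strict. *)
Lemma pdmx_scalar_sub d (S : 'M[R]_d) : S^T = S ->
  exists b0 : R, forall b, b0 <= b -> pdmx (b%:M - S).
Proof.
move=> ST; pose c : R := \sum_i \sum_j `|S i j|.
exists (c + 1) => b cb; split=> [|v v0].
  by rewrite linearB /= tr_scalar_mx ST.
rewrite -/(qform _ v) qformD qformN qform_scalar subr_gt0.
set V := (v^T *m v) 0 0; have V0 : 0 < V by exact: normsq_gt0.
have vi i : v i 0 ^+ 2 <= V.
  rewrite /V normsqE (bigD1 i) //= lerDl.
  by apply: sumr_ge0 => j _; rewrite sqr_ge0.
have le_c : qform S v <= c * V.
  rewrite /qform -mulmxA mxE /c mulr_suml; apply: ler_sum => i _.
  rewrite !mxE mulr_sumr mulr_suml; apply: ler_sum => j _.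
  apply: le_trans (ler_norm _) _; rewrite mulrCA !normrM.
  apply: ler_wpM2l => //; rewrite -normrM.
  (* Both bounds on the product [v i 0 * v j 0] come from expanding the square of a sum or
     difference, each entry having square at most [V]. *)
  have h1 := vi i; have h2 := vi j.
  rewrite ler_norml; apply/andP; split.
    have := sqr_ge0 (v i 0 + v j 0); rewrite sqrrD => h.
    by nra.
  have := sqr_ge0 (v i 0 - v j 0); rewrite sqrrB => h.
  by nra.
apply: le_lt_trans le_c _; rewrite ltr_pM2r //.
by apply: lt_le_trans cb; rewrite ltrDl.
Qed.

(** The Schur complement is [P *m (invmx P - H^T *m invmx M *m H) *m P], and congruence by [P]
    preserves definiteness. This removes the products of decision variables hidden in the LMIs. *)
Lemma pdmx_schur_factor d e (M : 'M[R]_d) (H : 'M[R]_(d, e)) (P : 'M[R]_e) :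
  M \in unitmx -> M^T = M -> P \in unitmx -> P^T = P ->
  pdmx (block_mx M (H *m P) (H *m P)^T P) <->
  pdmx M /\ pdmx (invmx P - H^T *m invmx M *m H).
Proof.
move=> Mu MT Pu PT; rewrite pdmx_schur //.
rewrite -(pdmx_congr_unit (invmx P - _) Pu) mulmxBr mulmxBl PT mulmxV // mul1mx.
by rewrite trmx_mul PT !mulmxA.
Qed.

(** An explicit root, [xi *m xi^T] divided by the norm of [xi], shows that [sqrtmx] does not take
    its junk value here. *)
Lemma sqrtmx_outer d (xi : 'cV[R]_d) :
  (sqrtmx (xi *m xi^T))^T = sqrtmx (xi *m xi^T) /\
  sqrtmx (xi *m xi^T) *m sqrtmx (xi *m xi^T) = xi *m xi^T.
Proof.
rewrite /sqrtmx; set P := [set S | _]%classic.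
suff : exists S, P S by move/(xgetPex 0) => [[-> _] ->].
pose c := (xi^T *m xi) 0 0; have c0 : 0 <= c by exact: normsq_ge0.
have cE : xi^T *m xi = c%:M by rewrite [LHS]mx11_scalar.
exists ((Num.sqrt c)^-1 *: (xi *m xi^T)); split.
  split=> [|v]; first by rewrite linearZ /= trmx_mul trmxK.
  rewrite -/(qform _ v) qformZ mulr_ge0 ?invr_ge0 ?sqrtr_ge0 //.
  by rewrite -{1}[xi]trmxK qform_gram normsq_ge0.
rewrite -scalemxAl -scalemxAr scalerA -invfM -expr2 sqr_sqrtr //.
rewrite -mulmxA (mulmxA xi^T) cE mul_scalar_mx -scalemxAr scalerA.
(* If the norm is zero, its inverse is 0 by convention, and both sides vanish with [xi]. *)
have [c00|c00] := eqVneq c 0; last by rewrite mulVf // scale1r.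
suff -> : xi = 0 by rewrite mul0mx scaler0.
by apply/eqP; apply: contraT => /normsq_gt0; rewrite -/c c00 ltxx.
Qed.

(* In the coordinates [(t, z - t x)] the vector [(1, x)] becomes [(1, 0)], and
   the form sought is [a t^2 + b |z - t x|^2] with [b] large. *)
Lemma dominating_form n (x : 'cV[R]_n) (a : R) (l : seq 'M[R]_(1 + n)) :
  (forall M, M \in l -> M^T = M /\ qform M (col_mx 1%:M x) < a) ->
  exists W : 'M[R]_(1 + n), [/\ W^T = W, qform W (col_mx 1%:M x) = a &
    forall M, M \in l -> pdmx (W - M)].
Proof.
pose T : 'M[R]_(1 + n) := block_mx 1%:M 0 (- x) 1%:M.
pose S : 'M[R]_(1 + n) := block_mx 1%:M 0 x 1%:M.
have ST : S *m T = 1%:M.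
  rewrite mulmx_block !(mul1mx, mulmx1, mul0mx, mulmx0, addr0, add0r) subrr.
  by rewrite -scalar_mx_block.
have Tu : T \in unitmx by case/mulmx1_unit: ST.
have Sxi : S *m col_mx 1%:M 0 = col_mx 1%:M x.
  by rewrite mul_block_col !(mul1mx, mulmx1, mul0mx, mulmx0, addr0, add0r).
have Txi : T *m col_mx 1%:M x = col_mx 1%:M 0.
  rewrite mul_block_col !(mul1mx, mulmx1, mul0mx, mulmx0, addr0, add0r).
  by rewrite addrC subrr.
pose D b : 'M[R]_(1 + n) := block_mx a%:M 0 0 b%:M.
pose W b := T^T *m D b *m T.
have DT b : (D b)^T = D b by rewrite tr_block_mx !tr_scalar_mx !trmx0.
move=> hl.
(* Asking for all [b] above a threshold lets the thresholds of the individual forms be combined by a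
   maximum. *)
have {hl} [b hb] : exists b0, forall b, b0 <= b ->
    forall M, M \in l -> pdmx (W b - M).
  elim: l hl => [|M l IH] hl; first by exists 0.
  have [|b1 hb1] := IH.
    by move=> M' M'l; apply: hl; rewrite inE M'l orbT.
  have [MT Ma] := hl M (mem_head _ _).
  suff [b2 hb2] : exists b0, forall b, b0 <= b -> pdmx (W b - M).
    exists (Num.max b1 b2) => b; rewrite ge_max => /andP[/hb1 {}hb1 /hb2 {}hb2].
    by move=> M'; rewrite inE => /predU1P[->|/hb1].
  (* [N] is [M] in the new coordinates; its upper left entry is the value of [M] at [(1, x)], so it
     lies below [a] by a gap [c > 0]. *)
  pose N := S^T *m M *m S.
  have WE b : W b - M = T^T *m (D b - N) *m T.
    rewrite mulmxBr mulmxBl; congr (_ - _); rewrite /N !mulmxA -trmx_mul ST.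
    by rewrite trmx1 mul1mx -mulmxA ST mulmx1.
  have NT : N^T = N by rewrite /N !trmx_mul MT trmxK mulmxA.
  have Nqa : qform N (col_mx 1%:M 0) < a by rewrite qform_congr Sxi.
  move: NT Nqa WE; rewrite -[N]submxK.
  set N11 := ulsubmx N; set N12 := ursubmx N.
  set N21 := dlsubmx N; set N22 := drsubmx N.
  rewrite tr_block_mx => /eq_block_mx[NT11 _ N12E NT22].
  rewrite /qform tr_col_mx trmx1 trmx0 mul_row_block mul_row_col.
  rewrite !(mul1mx, mulmx1, mul0mx, mulmx0, addr0, add0r) => Na WE.
  have N11E : a%:M - N11 = (a - N11 0 0)%:M.
    by rewrite [N11 in LHS]mx11_scalar raddfB.
  set c := a - N11 0 0 in N11E; have c0 : 0 < c by rewrite subr_gt0.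
  (* Chosen so that the Schur complement of [c] in [D b - N] is [b%:M - N']. *)
  pose N' : 'M_n := N22 + (- N12)^T *m invmx (c%:M) *m (- N12).
  have [|b0 hb0] := @pdmx_scalar_sub _ N'.
    rewrite /N' linearD /= NT22 !trmx_mul trmxK trmx_inv tr_scalar_mx.
    by rewrite mulmxA.
  exists b0 => b /hb0 hb; rewrite WE pdmx_congr_unit // /D.
  rewrite opp_block_mx add_block_mx !add0r N11E -N12E.
  have -> : - N12^T = (- N12)^T by rewrite linearN.
  have pc := pdmx_scalar 1 c0.
  apply/pdmx_schur; [exact: pdmx_unit pc|exact: tr_scalar_mx|split=> //].
  by move: hb; rewrite /N' opprD addrA.
exists (W b); split; last exact: hb.
  by rewrite !trmx_mul trmxK DT mulmxA.
rewrite qform_congr Txi qform_block !qform_scalar mulmx0 trmx1 mulmx1 !mxE.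
by rewrite eqxx mulr1 mulr0 addr0.
Qed.

End QuadraticForms.

(** * From the LMIs to inequalities between closed-loop quadratic forms *)

Section Duality.
Set Implicit Arguments.
Unset Strict Implicit.
Variables (R : realType) (N n m s : nat) (p : ocp R N n m s).

Definition xi0 : 'cV[R]_(1 + n) := col_mx 1%:M (xbar p).

Lemma sqrt_Sigma0 : (sqrtmx (Sigma0 p))^T = sqrtmx (Sigma0 p) /\
  sqrtmx (Sigma0 p) *m sqrtmx (Sigma0 p) = xi0 *m xi0^T.
Proof. exact: sqrtmx_outer. Qed.

Section ClosedLoop.
Variable kap : 'I_N -> 'M[R]_(m, 1 + n).

Definition clA k : 'M[R]_(1 + n) :=
  col_mx (row_mx 1%:M 0) (row_mx (f_ p k) (A_ p k) + B1_ p k *m kap k).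
Definition clC k : 'M[R]_(dimy p k, 1 + n) :=
  row_mx (g1_ p k) (C1_ p k) + D11_ p k *m kap k.
Definition clG k i : 'M[R]_(Defs.dimv p k i, 1 + n) :=
  row_mx (g2_ p k i) (C2_ p k i) + D21_ p k i *m kap k.

Lemma clA_mul k x : clA k *m col_mx 1%:M x =
  col_mx 1%:M (f_ p k + A_ p k *m x + B1_ p k *m (kap k *m col_mx 1%:M x)).
Proof.
rewrite mul_col_mx mulmxDl !mul_row_col mul0mx !mulmx1 addr0.
by rewrite -!mulmxA.
Qed.

Lemma clG_mul k i x : clG k i *m col_mx 1%:M x =
  g2_ p k i + C2_ p k i *m x + D21_ p k i *m (kap k *m col_mx 1%:M x).
Proof. by rewrite mulmxDl mul_row_col mulmx1 -mulmxA. Qed.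

End ClosedLoop.

(* The LMIs after the change of variables [V k = P_k^-1], [kap k = K_k V k],
   [lam = 1 / nu] and elimination of [Z]. *)
Definition value_certificate (V : 'I_N.+1 -> 'M[R]_(1 + n))
    (kap : 'I_N -> 'M[R]_(m, 1 + n)) (lam : R) : Prop :=
  [/\ forall k, pdmx (V k),
      pdmx (V ord_max - Pf p),
      qform (V ord0) xi0 < lam,
      forall k, pdmx (V (now k) - ((clA kap k)^T *m V (Defs.next k) *m clA kap k
                                   + (clC kap k)^T *m clC kap k)) &
      forall k i, pdmx (V (now k) - lam *: ((clG kap k i)^T *m clG kap k i))].

Section ChangeOfVariables.
Variables (w : sdp_var R N n m) (kap : 'I_N -> 'M[R]_(m, 1 + n)).
Hypothesis PT : forall k, (P_ w k)^T = P_ w k.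
Hypothesis Pu : forall k, P_ w k \in unitmx.
Hypothesis KE : forall k, K_ w k = kap k *m P_ w (now k).

Lemma fAKE k : fAK p w k =
  (row_mx (f_ p k) (A_ p k) + B1_ p k *m kap k) *m P_ w (now k).
Proof. by rewrite /fAK KE mul_row_col mulmxDl mulmxA. Qed.

Lemma gC1KE k : gC1K p w k = clC kap k *m P_ w (now k).
Proof. by rewrite /gC1K KE mul_row_col mulmxDl mulmxA. Qed.

Lemma gC2KE k i : gC2K p w k i = clG kap k i *m P_ w (now k).
Proof. by rewrite /gC2K KE mul_row_col mulmxDl mulmxA. Qed.

(** Since [usubmx P] is [row_mx 1%:M 0 *m P], the whole off-diagonal block is the closed-loop matrix
    times [P], and [pdmx_schur_factor] applies with [D] as the upper left block. *)
Lemma lmi_dynamicsP k : pdmx (lmi_dynamics p w k) <->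
  pdmx (P_ w (Defs.next k)) /\
  pdmx (invmx (P_ w (now k)) -
    ((clA kap k)^T *m invmx (P_ w (Defs.next k)) *m clA kap k
     + (clC kap k)^T *m clC kap k)).
Proof.
set P := P_ w (now k); set P' := P_ w (Defs.next k).
pose D : 'M[R]_(1 + n + dimy p k) := block_mx P' 0 0 1%:M.
have Du : D \in unitmx.
  by rewrite unitmxE det_ublock det1 mulr1 -unitmxE; apply: Pu.
have DT : D^T = D by rewrite tr_block_mx !trmx0 trmx1 PT.
have uE : usubmx P = row_mx 1%:M 0 *m P.
  by rewrite -{2}[P]vsubmxK mul_row_col mul1mx mul0mx addr0.
have XE : col_mx (col_mx (usubmx P) (fAK p w k)) (gC1K p w k) =
    col_mx (clA kap k) (clC kap k) *m P.
  by rewrite fAKE gC1KE -/P uE -!mul_col_mx.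
have -> : lmi_dynamics p w k = block_mx D (col_mx (clA kap k) (clC kap k) *m P)
    (col_mx (clA kap k) (clC kap k) *m P)^T P.
  by rewrite -XE /lmi_dynamics !tr_col_mx -/P -/P' trmx_usub PT.
rewrite pdmx_schur_factor ?Pu ?PT // pdmx_diag_block.
have -> : invmx D = block_mx (invmx P') 0 0 1%:M.
  by rewrite invmx_block_diag // invmx1.
rewrite tr_col_mx mul_row_block !mulmx0 addr0 add0r mulmx1 mul_row_col.
by split=> [[[]]|[? ?]] //; do 2?split=> //; apply: pdmx_scalar.
Qed.

Lemma lmi_outputP k i : 0 < nu w -> pdmx (lmi_output p w k i) <->
  pdmx (invmx (P_ w (now k)) - (nu w)^-1 *: ((clG kap k i)^T *m clG kap k i)).
Proof.
move=> nu0; rewrite /lmi_output -{2}[gC2K p w k i]trmxK pdmx_block_swap trmxK.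
have pnu := pdmx_scalar (Defs.dimv p k i) nu0.
rewrite gC2KE pdmx_schur_factor ?Pu ?PT ?tr_scalar_mx ?(pdmx_unit pnu) //.
rewrite invmx_scalar mul_mx_scalar -scalemxAl.
by split=> [[]|].
Qed.

Lemma lmi_initialP : pdmx (lmi_initial p w) <-> pdmx (P_ w ord0) /\
  pdmx (Z w - nu w ^+ 2 *:
    (sqrtmx (Sigma0 p) *m invmx (P_ w ord0) *m sqrtmx (Sigma0 p))).
Proof.
have [ST _] := sqrt_Sigma0.
rewrite /lmi_initial -linearZ /= pdmx_schur ?Pu ?PT //.
by rewrite [_^T]linearZ /= ST -scalemxAr -!scalemxAl scalerA -expr2.
Qed.

(** Cyclicity of the trace brings the two roots together. With [lmi_initialP] this turns the trace
    bound on [Z] into a bound on the form at [xi0]. *)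
Lemma trace_sqrt_Sigma0 (V0 : 'M[R]_(1 + n)) :
  \tr (sqrtmx (Sigma0 p) *m V0 *m sqrtmx (Sigma0 p)) = qform V0 xi0.
Proof.
have [_ SS] := sqrt_Sigma0.
by rewrite mxtrace_mulC mulmxA SS -mulmxA mxtrace_mulC trace_mx11.
Qed.

End ChangeOfVariables.

Lemma sdp_strictly_feasibleP : pdmx (Pf p) -> sdp_strictly_feasible p <->
  exists V kap lam, 0 < lam /\ value_certificate V kap lam.
Proof.
move=> pPf; split=> [[w [[PT ZT] hdyn [hin htr] hf hout]]|].
  (* [P_ w ord0] is a diagonal block of the initial LMI, and each later [P_] is one of the preceding
     dynamics LMI. *)
  have pP : forall k, pdmx (P_ w k).
    elim/stage_ind => [|k _]; first exact: pdmx_ulblock hin.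
    by do 2!apply: pdmx_ulblock; apply: hdyn.
  have Pu k : P_ w k \in unitmx by apply: pdmx_unit.
  pose kap k := K_ w k *m invmx (P_ w (now k)).
  have KE k : K_ w k = kap k *m P_ w (now k) by rewrite mulmxKV.
  (* Taking traces gives [nu ^+ 2 * q <= \tr Z < nu], with [q] the value of [invmx (P_ w ord0)] at
     [xi0]; this forces [nu > 0] and then [q < nu^-1]. *)
  have [_ /pdmx_tr_ge0] := (lmi_initialP PT Pu).1 hin.
  rewrite linearB /= linearZ /= trace_sqrt_Sigma0 subr_ge0 => hnu.
  have {htr}hnu := le_lt_trans hnu htr.
  have nu0 : 0 < nu w.
    apply: le_lt_trans hnu; rewrite mulr_ge0 ?sqr_ge0 ?pdmx_ge0 //.
    exact: pdmx_inv.
  exists (fun k => invmx (P_ w k)), kap, (nu w)^-1.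
  split; first by rewrite invr_gt0.
  split=> [k|||k|k i].
  - exact: pdmx_inv.
  - exact/(pdmx_inv_sub (pP _) pPf).
  - by move: hnu; rewrite expr2 -mulrA gtr_pMr // mulrC -ltr_pdivlMr // mul1r.
  - by have [] := (lmi_dynamicsP PT Pu KE k).1 (hdyn k).
  - exact/(lmi_outputP PT Pu KE k i nu0).
move=> [V [kap [lam [lam0 [pV hf hin hdyn hout]]]]].
have nu0 : 0 < lam^-1 by rewrite invr_gt0.
(* [Z] will be its lower bound plus [e%:M]. The trace slack is cut into [n + 2] shares, of which
   [e%:M] uses only [n + 1], so both inequalities on [Z] stay strict. *)
pose e := (lam^-1 - lam^-1 ^+ 2 * qform (V ord0) xi0) / (n.+2)%:R.
have e0 : 0 < e.
  rewrite divr_gt0 // subr_gt0 expr2 -mulrA gtr_pMr // mulrC ltr_pdivrMr //.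
  by rewrite mul1r.
pose w := SdpVar (fun k => invmx (V k)) (fun k => kap k *m invmx (V (now k)))
  lam^-1
  (lam^-1 ^+ 2 *: (sqrtmx (Sigma0 p) *m V ord0 *m sqrtmx (Sigma0 p)) + e%:M).
have pP k : pdmx (P_ w k) by apply: pdmx_inv.
have PT k : (P_ w k)^T = P_ w k by case: (pP k).
have Pu k : P_ w k \in unitmx by apply: pdmx_unit.
have KE k : K_ w k = kap k *m P_ w (now k) by [].
have [ST _] := sqrt_Sigma0.
exists w; split=> [|k|||k i].
- split=> //=; rewrite linearD /= linearZ /= tr_scalar_mx !trmx_mul ST.
  by rewrite (pV ord0).1 mulmxA.
- apply/(lmi_dynamicsP PT Pu KE); split; first exact: pP.
  by rewrite /= !invmxK.
- split.
    apply/(lmi_initialP PT Pu); split; first exact: pP.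
    by rewrite /= invmxK addrC addKr; apply: pdmx_scalar.
  rewrite /= linearD /= linearZ /= trace_sqrt_Sigma0 mxtrace_scalar.
  rewrite -ltrBrDl -mulr_natr /e -mulrA gtr_pMr; last first.
    by move: e0; rewrite /e pmulr_lgt0 // invr_gt0.
  by rewrite mulrC ltr_pdivrMr // mul1r ltr_nat.
- apply/(pdmx_inv_sub (pP _) pPf).
  by rewrite /= invmxK.
- by apply/(lmi_outputP PT Pu KE k i nu0); rewrite /= invmxK invrK.
Qed.

End Duality.

(** * Certificates and strictly feasible input sequences *)

Section Certificates.
Set Implicit Arguments.
Unset Strict Implicit.
Variables (R : realType) (N n m s : nat) (p : ocp R N n m s).

Lemma value_certificate_feasible V kap lam : 0 < lam ->
  value_certificate p V kap lam ->
  exists (u : 'I_N -> 'cV[R]_m) (x : 'I_N.+1 -> 'cV[R]_n),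
    trajectory p u x /\ forall k i,
      ((voutput p u x k i)^T *m voutput p u x k i) 0 0 < 1.
Proof.
move=> lam0 [pV _ hin hdyn hout].
have [x [x0 xS]] := forward_family
  (fun k x => f_ p k + A_ p k *m x + B1_ p k *m (kap k *m col_mx 1%:M x))
  (xbar p).
pose xi k : 'cV[R]_(1 + n) := col_mx 1%:M (x k).
have xi_neq0 k : xi k != 0.
  by rewrite /xi col_mx_eq0 -[1%:M]/(1 : 'M[R]_1) oner_eq0.
have xiS k : xi (Defs.next k) = clA p kap k *m xi (now k).
  by rewrite /xi clA_mul xS.
have Vlt : forall k, qform (V k) (xi k) < lam.
  elim/stage_ind => [|k IH]; first by rewrite /xi x0.
  apply: le_lt_trans IH; rewrite xiS -qform_congr.
  (* Evaluated at [xi (now k)], the dynamics inequality bounds the next value plus the squared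
     output [y_k]; the latter is nonnegative and is dropped. *)
  have := (hdyn k).2 _ (xi_neq0 (now k)).
  rewrite -/(qform _ _) qformD qformN qformD subr_gt0 => /ltW.
  by apply: le_trans; rewrite lerDl qform_gram normsq_ge0.
exists (fun k => kap k *m xi (now k)), x; split=> // k i.
rewrite /voutput -clG_mul -qform_gram -/(xi _).
have := (hout k i).2 _ (xi_neq0 (now k)).
rewrite -/(qform _ _) qformD qformN qformZ subr_gt0 => h.
by have := lt_trans h (Vlt (now k)); rewrite gtr_pMr.
Qed.

(* Along the given trajectory [q_{V_k}(1, x_k)] is prescribed to be
   [lam r + c_k], where [r < 1] bounds all [|v_ki|^2] and [c] strictly dominates
   the cost to go; a large [lam] makes [lam r + c_0 < lam]. *)
Lemma feasible_value_certificate u x : trajectory p u x ->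
  (forall k i, ((voutput p u x k i)^T *m voutput p u x k i) 0 0 < 1) ->
  pdmx (Pf p) ->
  exists V kap lam, 0 < lam /\ value_certificate p V kap lam.
Proof.
move=> [x0 xS] hv pPf.
(* This feedback returns [u k] whatever the state. *)
pose kap k : 'M[R]_(m, 1 + n) := row_mx (u k) 0.
pose xi k : 'cV[R]_(1 + n) := col_mx 1%:M (x k).
have kapE k y : kap k *m col_mx 1%:M y = u k.
  by rewrite mul_row_col mulmx1 mul0mx addr0.
have AE k : clA p kap k *m xi (now k) = xi (Defs.next k).
  by rewrite /xi clA_mul kapE xS.
have GE k i : qform ((clG p kap k i)^T *m clG p kap k i) (xi (now k)) =
    ((voutput p u x k i)^T *m voutput p u x k i) 0 0.
  by rewrite qform_gram clG_mul kapE.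
(* The default 0 ensures [0 <= r], and [r < 1] even when there are no constraints. *)
pose r := \big[Num.max/0]_(ki : 'I_N * 'I_s)
  qform ((clG p kap ki.1 ki.2)^T *m clG p kap ki.1 ki.2) (xi (now ki.1)).
have r1 : r < 1 by apply/bigmax_ltP; split=> // ki _; rewrite GE.
have r0 : 0 <= r by apply: bigmax_ge_id.
have rG k i : qform ((clG p kap k i)^T *m clG p kap k i) (xi (now k)) <= r.
  exact: (le_bigmax _ _ (k, i)).
pose y2 k := qform ((clC p kap k)^T *m clC p kap k) (xi (now k)).
have y20 k : 0 <= y2 k by rewrite /y2 qform_gram normsq_ge0.
(* The strict drop of [c] by more than [y2 k] leaves room for the strict dynamics inequality along
   the trajectory. *)
have [|k c' c'0|c [c0 cS]] := @backward_family R N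
    (fun k c => 0 < c /\ (k = ord_max -> qform (Pf p) (xi k) < c))
    (fun k c c' => c' + y2 k < c).
- exists (qform (Pf p) (xi ord_max) + 1).
  by rewrite ltr_wpDl ?pdmx_ge0 // ltrDl.
- exists (c' + y2 k + 1); rewrite ltrDl; split=> //; split.
    by rewrite ltr_wpDl // addr_ge0 // ltW //; case: c'0.
  by move/now_neq_max.
(* The solution of [lam * r + c ord0 = lam - 1]. *)
pose lam := (c ord0 + 1) / (1 - r).
have d0 : 0 < 1 - r by rewrite subr_gt0.
have lam0 : 0 < lam by rewrite divr_gt0 // ltr_wpDl //; case: (c0 ord0) => /ltW.
have lamE : lam = lam * r + c ord0 + 1.
  have lam1r : lam * (1 - r) = c ord0 + 1 by rewrite divfK // gt_eqF.
  by rewrite -addrA -lam1r -mulrDr [r + _]addrC subrK mulr1.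
have [||V [QV SV]] := @backward_family 'M[R]_(1 + n) N
    (fun k W => [/\ pdmx W, qform W (xi k) = lam * r + c k &
      k = ord_max -> pdmx (W - Pf p)])
    (fun k W W' => pdmx (W - ((clA p kap k)^T *m W' *m clA p kap k
                              + (clC p kap k)^T *m clC p kap k)) /\
      forall i, pdmx (W - lam *: ((clG p kap k i)^T *m clG p kap k i))).
- have [M|W [_ WE hW]] := @dominating_form R n (x ord_max) (lam * r + c ord_max)
    [:: 0; Pf p].
    have [cN /(_ erefl) PfN] := c0 ord_max.
    rewrite !inE => /orP[]/eqP ->; split; rewrite ?trmx0 ?pPf.1 //.
      by rewrite /qform mulmx0 mul0mx mxE ltr_wpDl // mulr_ge0 // ltW.
    by rewrite ltr_wpDl // mulr_ge0 // ltW.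
  exists W; split=> // [|_]; last by apply: hW; rewrite !inE eqxx orbT.
  by rewrite -[W]subr0; apply: hW; rewrite inE eqxx.
- move=> k W' [pW' W'E _].
  (* Dominating the zero form makes [W] positive definite; the other forms are the right-hand sides
     of the dynamics and output inequalities. Their values are below [lam * r + c (now k)] by
     [c > 0], [cS] and [rG]. *)
  have [M|W [_ WE hW]] := @dominating_form R n (x (now k)) (lam * r + c (now k))
    [:: 0, (clA p kap k)^T *m W' *m clA p kap k + (clC p kap k)^T *m clC p kap k
      & [seq lam *: ((clG p kap k i)^T *m clG p kap k i) | i <- enum 'I_s]].
    have ck : 0 < c (now k) by case: (c0 (now k)).
    rewrite !inE => /orP[/eqP->|/orP[/eqP->|/mapP[i _ ->]]].
    - rewrite trmx0 /qform mulmx0 mul0mx mxE; split=> //.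
      by rewrite ltr_wpDl // mulr_ge0 // ltW.
    - rewrite linearD /= !trmx_mul !trmxK pW'.1 mulmxA; split=> //.
      by rewrite qformD qform_congr AE W'E -addrA ltrD2l cS.
    - rewrite linearZ /= trmx_mul trmxK; split=> //.
      by rewrite qformZ ltr_pwDr // ler_wpM2l ?rG // ltW.
  exists W; split; [split=> //|split=> [|i]].
  + by rewrite -[W]subr0; apply: hW; rewrite inE eqxx.
  + by move/now_neq_max.
  + by apply: hW; rewrite !inE eqxx orbT.
  + by apply: hW; rewrite !inE; apply/orP; right; apply/orP; right;
      apply: map_f; rewrite mem_enum.
exists V, kap, lam; split=> //; split=> [k|||k|k i].
- by case: (QV k).
- by case: (QV ord_max) => _ _; apply.
- have [_ + _] := QV ord0; rewrite /xi x0 -/(xi0 p) => ->.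
  by rewrite [ltRHS]lamE ltrDl.
- by case: (SV k).
- by case: (SV k).
Qed.

End Certificates.

Theorem theorem2 (R : realType) (N n m s : nat) (p : ocp R N n m s)
    (hPf : pdmx (Pf p)) :
  (exists (u : 'I_N -> 'cV[R]_m) (x : 'I_N.+1 -> 'cV[R]_n),
     trajectory p u x /\
     forall (k : 'I_N) (i : 'I_s),
       ((voutput p u x k i)^T *m voutput p u x k i) 0 0 < 1)
  <-> sdp_strictly_feasible p.
Proof.
rewrite sdp_strictly_feasibleP //; split.
  by move=> [u [x [hx hv]]]; apply: feasible_value_certificate hx hv hPf.
by move=> [V [kap [lam [lam0 h]]]]; apply: value_certificate_feasible lam0 h.
Qed.
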